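(* Let $k\ge 2$ and $n=2k+1$. The friendship graph $F^{k}_{n}$ is determined by its $D$-spectrum: every connected graph $D$-cospectral to $F^{k}_{n}$ is isomorphic to $F^{k}_{n}$.
   Context: All graphs are simple, undirected and connected. For a connected graph $G$, the distance matrix $D(G)$ has as $(i,j)$-entry the distance between the $i$-th and $j$-th vertices; its eigenvalues form the $D$-spectrum of $G$. Two graphs are $D$-cospectral if they have the same $D$-spectrum; $G$ is determined by its $D$-spectrum if every graph $D$-cospectral to $G$ is isomorphic to $G$. The friendship graph $F^{k}_{n}$ ($n=2k+1$) is the graph obtained by taking $k$ copies of the cycle $C_3$ and identifying one vertex from each copy into a single common vertex. *)

(* Defs.v *)
From mathcomp Require Import all_boot all_order all_algebra all_field.
Set Implicit Arguments. Unset Strict Implicit. Unset Printing Implicit Defensive.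
Import GRing.Theory Num.Theory.

Definition simple_graph (T : finType) (e : rel T) : Prop :=
  symmetric e /\ irreflexive e.

Definition connected_graph (T : finType) (e : rel T) : Prop :=
  forall x y : T, connect e x y.

Definition walk (T : finType) (e : rel T) (k : nat) (x y : T) : bool :=
  [exists p : k.-tuple T, path e x p && (last x p == y)].

(* graph distance: the least length of a walk from x to y
   (for connected graphs it is < #|T|; #|T| is a dummy default). *)
Definition gdist (T : finType) (e : rel T) (x y : T) : nat :=
  \big[minn/#|T|]_(k < #|T| | walk e k x y) k.

Definition distmx (n : nat) (e : rel 'I_n) : 'M[algC]_n :=
  \matrix_(i, j) ((gdist e i j)%:R)%R.

(* D-spectrum = multiset of eigenvalues of D(G) = roots (with multiplicity)
   of its characteristic polynomial over algC (algebraically closed). *)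
Definition D_cospectral (m n : nat) (e : rel 'I_m) (f : rel 'I_n) : Prop :=
  char_poly (distmx e) = char_poly (distmx f).

Definition isomorphic (m n : nat) (e : rel 'I_m) (f : rel 'I_n) : Prop :=
  exists g : 'I_m -> 'I_n, bijective g /\ forall x y, e x y = f (g x) (g y).

(* Friendship graph F^k_{2k+1}: centre 0, triangles {0, 2i-1, 2i}, i=1..k. *)
Definition friendship (k : nat) : rel 'I_(2 * k + 1) :=
  fun x y => (x != y) &&
    [|| (x : nat) == 0%N, (y : nat) == 0%N | (x.-1)./2 == (y.-1)./2].
Arguments friendship k x y : clear implicits.

(* Main.v *)
(** The distance matrix D of the friendship graph satisfies two matrix identities:
    D + 3 I is a sum of Gram matrices, and D + I/2 is w w^T / 2 minus a Gram
    matrix.  Hence every eigenvalue is at least -3, and the form of D is at most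
    -1/2 on a hyperplane.  Cospectral real symmetric matrices are unitarily
    similar, so a cospectral graph G inherits both facts.  They forbid a path
    x v w u with x, w and v, u non adjacent: if d(x,u) = 3 the first one fails at
    (2,1,-1,-2), and if d(x,u) <= 2 the second one fails on the plane spanned by
    (1,1,1,1) and (1,-2,2,-1).  A connected graph without such a path has a
    universal vertex v, so that its distance matrix is 2(J - I) - A.  With d_i the
    degrees, the traces of D^2 and D^3 determine sum d_i and
    6 sum d_i^2 - tr A^3; comparing tr A^3 with sums over the d_i then gives
    sum (d_i - 2)^2 <= 0 over i <> v, so G - v is a perfect matching. *)
Require Import Defs.
From mathcomp Require Import all_boot all_fingroup all_order all_algebra all_field.
From mathcomp Require Import ring zify.
Set Implicit Arguments. Unset Strict Implicit. Unset Printing Implicit Defensive.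
Import Order.TTheory GRing.Theory Num.Theory.
Local Open Scope ring_scope.
Local Open Scope sesquilinear_scope.

(** * Unitary similarity and Hermitian forms *)

Lemma char_poly_conjmx (R : comUnitRingType) n (P A : 'M[R]_n) : P \in unitmx ->
  char_poly (invmx P *m A *m P) = char_poly A.
Proof.
move=> uP; rewrite /char_poly.
have -> : char_poly_mx (invmx P *m A *m P) =
    map_mx polyC (invmx P) *m char_poly_mx A *m map_mx polyC P.
  rewrite /char_poly_mx mulmxBr mulmxBl !map_mxM /= scalar_mxC -(mulmxA 'X%:M) -!map_mxM.
  by rewrite mulVmx // map_mx1 mulmx1.
by rewrite !det_mulmx mulrAC -det_mulmx -map_mxM mulVmx // map_mx1 det1 mul1r.
Qed.

(** By the spectral theorem both matrices are unitarily diagonalisable; equal characteristic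
    polynomials make the diagonals agree up to a permutation, and permutation matrices are
    unitary. *)
Lemma cospectral_unitarily_similar (C : numClosedFieldType) n (A B : 'M[C]_n) :
  A \is normalmx -> B \is normalmx -> char_poly A = char_poly B ->
  exists2 U : 'M[C]_n, U \is unitarymx & A = U *m B *m U^t*.
Proof.
move=> /orthomx_spectralP eqA /orthomx_spectralP eqB.
set P := spectralmx A in eqA; set a := spectral_diag A in eqA.
set Q := spectralmx B in eqB; set b := spectral_diag B in eqB.
have uP : P \is unitarymx by exact: spectral_unitarymx.
have uQ : Q \is unitarymx by exact: spectral_unitarymx.
have char_diag (d : 'rV[C]_n) :
    char_poly (diag_mx d) = \prod_(x <- [tuple d 0 i | i < n]) ('X - x%:P).
  rewrite big_tuple char_poly_trig; last by apply/is_diag_mx_is_trig/diag_mx_is_diag.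
  by apply: eq_bigr => i _; rewrite tnth_mktuple mxE eqxx.
rewrite eqA eqB !char_poly_conjmx ?unitarymx_unit // !char_diag.
move=> /prod_XsubC_eq /tuple_permP [s eq_ab].
have {}eq_ab i : a 0 i = b 0 (s i).
  have := congr1 (fun t : seq C => nth 0 t i) eq_ab.
  by rewrite -!tnth_nth !tnth_mktuple.
have uS : perm_mx s \is @unitarymx C n n.
  by apply/unitarymxP; rewrite tr_perm_mx map_perm_mx -perm_mxM mulgV perm_mx1.
have eqD : diag_mx a = perm_mx s *m diag_mx b *m (perm_mx s)^t*.
  rewrite -row_permE tr_perm_mx map_perm_mx -col_permE.
  apply/matrixP => i j; rewrite !mxE eq_ab.
  by rewrite (inj_eq perm_inj).
exists (P^t* *m perm_mx s *m Q).
  by rewrite !mul_unitarymx ?trmxC_unitary.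
rewrite eqD !invmx_unitary // !trmx_mul !map_mxM trmxCK !mulmxA.
by rewrite !(mulmxtVK _ uQ).
Qed.

Definition hform n (A : 'M[algC]_n) (x : 'rV[algC]_n) : algC :=
  (x *m A *m x^t*) 0 0.

Lemma hform_conj n (A U : 'M[algC]_n) x :
  hform (U *m A *m U^t*) x = hform A (x *m U).
Proof. by rewrite /hform trmx_mul map_mxM !mulmxA. Qed.

(** [hform 1%:M] is the squared norm; its invariance lets bounds comparing a form with the norm pass
    between unitarily similar matrices. *)
Lemma hform1_unitary n (U : 'M[algC]_n) x :
  U \is unitarymx -> hform 1%:M (x *m U) = hform 1%:M x.
Proof. by move=> uU; rewrite -hform_conj mulmx1 (unitarymxP uU). Qed.

Lemma hformD n (A B : 'M[algC]_n) x : hform (A + B) x = hform A x + hform B x.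
Proof. by rewrite /hform mulmxDr mulmxDl mxE. Qed.

Lemma hformN n (A : 'M[algC]_n) x : hform (- A) x = - hform A x.
Proof. by rewrite /hform mulmxN mulNmx mxE. Qed.

Lemma hformZ n c (A : 'M[algC]_n) x : hform (c *: A) x = c * hform A x.
Proof. by rewrite /hform -scalemxAr -scalemxAl mxE. Qed.

Lemma hform_gram_ge0 m n (M : 'M[algC]_(n, m)) x : 0 <= hform (M *m M^t*) x.
Proof.
rewrite /hform !mulmxA -mulmxA -map_mxM -trmx_mul mxE.
by apply: sumr_ge0 => i _; rewrite !mxE mul_conjC_ge0.
Qed.

(** * Graph distance *)

Section Distance.
Variables (T : finType) (e : rel T).
Hypotheses (e_sym : symmetric e) (e_irr : irreflexive e).
Local Open Scope nat_scope.

Lemma walkP k x y :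
  reflect (exists p, [/\ size p = k, path e x p & last x p = y]) (walk e k x y).
Proof.
apply: (iffP existsP) => [[p /andP [ep /eqP lp]]|[p [sp ep lp]]].
  by exists p; rewrite size_tuple.
by move/eqP: sp => sp; exists (Tuple sp); rewrite /= ep lp eqxx.
Qed.

Lemma walk_gdist x y : gdist e x y < #|T| -> walk e (gdist e x y) x y.
Proof.
rewrite /gdist; elim/big_rec: _ => [|i d wi IHd]; first by rewrite ltnn.
by rewrite /minn; case: (ltnP i d).
Qed.

Lemma gdist_le k x y : walk e k x y -> gdist e x y <= k.
Proof.
rewrite /gdist -minEnat => wk; case: (ltnP k #|T|) => [lt_k|le_k].
  exact: (@bigmin_le_cond _ _ _ #|T| (Ordinal lt_k)).
(* Such a walk is too long to index the minimum, but the default value [#|T|] already bounds the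
   distance. *)
by apply: leq_trans le_k; exact: (@bigmin_le_id _ nat).
Qed.

Lemma gdistxx x : gdist e x x = 0.
Proof. by apply/eqP; rewrite -leqn0; apply/gdist_le/walkP; exists [::]. Qed.

Lemma gdist_gt0 x y : x != y -> 0 < gdist e x y.
Proof.
move=> neq_xy; case: posnP => // d0.
have /walk_gdist/walkP : gdist e x y < #|T| by rewrite d0; apply/card_gt0P; exists x.
by rewrite d0 => -[p [/eqP]]; rewrite size_eq0 => /eqP-> /= _ /eqP; rewrite (negPf neq_xy).
Qed.

Lemma gdist_edge x y : e x y -> gdist e x y = 1.
Proof.
move=> exy; apply/eqP; rewrite eqn_leq gdist_gt0 ?andbT.
  by apply/gdist_le/walkP; exists [:: y]; rewrite /= exy.
by apply: contraTneq exy => ->; rewrite e_irr.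
Qed.

Lemma gdist_gt1 x y : x != y -> ~~ e x y -> 1 < gdist e x y.
Proof.
move=> neq_xy nexy; rewrite ltn_neqAle gdist_gt0 // andbT; apply/eqP => d1.
have /walk_gdist/walkP : gdist e x y < #|T|.
  by rewrite -d1; apply/card_gt1P; exists x, y.
rewrite -d1 => -[[|z [|? ?]] [] //= _ /andP [exz _] eq_zy].
by rewrite -eq_zy exz in nexy.
Qed.

Lemma gdist_le2 x y z : e x y -> e y z -> gdist e x z <= 2.
Proof. by move=> exy eyz; apply/gdist_le/walkP; exists [:: y; z]; rewrite /= exy eyz. Qed.

Lemma gdist_le3 x y z t : e x y -> e y z -> e z t -> gdist e x t <= 3.
Proof.
move=> exy eyz ezt; apply/gdist_le/walkP; exists [:: y; z; t].
by rewrite /= exy eyz ezt.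
Qed.

Lemma gdist_sym x y : gdist e x y = gdist e y x.
Proof.
suff walk_sym k a b : walk e k a b -> walk e k b a.
  rewrite /gdist; apply: eq_bigl => k; apply/idP/idP; exact: walk_sym.
move=> /walkP [p [sp ep lp]]; apply/walkP; exists (rev (belast a p)); split.
- by rewrite size_rev size_belast.
- by rewrite -lp rev_path (eq_path (e' := e)) // => u v; rewrite e_sym.
- by case: p lp {sp ep} => [<-|c p _] //=; rewrite rev_cons last_rcons.
Qed.

Definition universal v := forall x, x != v -> e v x.

Lemma gdist_universal v x y : universal v ->
  gdist e x y = if x == y then 0 else if e x y then 1 else 2.
Proof.
move=> univ; case: eqVneq => [->|neq_xy]; first exact: gdistxx.
case: ifPn => [/gdist_edge//|nexy].
apply/eqP; rewrite eqn_leq gdist_gt1 // andbT.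
have [eq_xv|neq_xv] := eqVneq x v.
  by rewrite eq_xv univ ?andbF // -?eq_xv 1?eq_sym in nexy.
have [eq_yv|neq_yv] := eqVneq y v.
  by rewrite eq_yv e_sym univ in nexy.
by apply: (@gdist_le2 _ v); [rewrite e_sym|]; apply: univ.
Qed.

(* A vertex [v] of maximal degree is universal, for otherwise some [u] at
   distance 2 from [v] has a common neighbour [w] with it, and [w], whose
   degree is at most that of [v], misses a neighbour of [v]. *)
Lemma universal_or_path4 : (forall x y, connect e x y) -> 0 < #|T| ->
  (exists v, universal v) \/
  (exists x v w u, [/\ e x v, e v w & e w u] /\
     [/\ ~~ e x w, ~~ e v u, x != w & v != u]).
Proof.
move=> conn /card_gt0P [x0 _].
pose deg x := #|[pred y | e x y]|.
case: (@arg_maxnP _ x0 predT deg isT) => v _ max_v.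
have [/forallP univ|] := boolP [forall x, (x != v) ==> e v x].
  by left; exists v => x; apply/implyP.
rewrite negb_forall => /existsP [z]; rewrite negb_imply => /andP [neq_zv nevz].
right.
have [/existsP [w /existsP [u /and4P [evw ewu nevu neq_vu]]]|] :=
    boolP [exists w, exists u, [&& e v w, e w u, ~~ e v u & v != u]]; last first.
  rewrite negb_exists => /forallP noP.
  (* Otherwise [v] and its neighbours are closed under adjacency, and connectedness puts [z] among
     them. *)
  pose a := [pred x | (x == v) || e v x].
  have cl : closed e a.
    apply: (intro_closed (sym_connect_sym e_sym)) => x y exy.
    rewrite !inE => /orP [/eqP eq_xv|evx]; first by rewrite -eq_xv exy orbT.
    have := noP x; rewrite negb_exists => /forallP /(_ y).
    by rewrite evx exy /= negb_and !negbK orbC eq_sym.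
  have := closed_connect cl (conn v z).
  by rewrite !inE eqxx (negPf neq_zv) (negPf nevz).
have [/existsP [x /and3P [evx nexw neq_xw]]|] :=
    boolP [exists x, [&& e v x, ~~ e x w & x != w]].
  by exists x, v, w, u; rewrite e_sym.
rewrite negb_exists => /forallP sub.
suff lt_vw : deg v < deg w by have /= := max_v w isT; rewrite leqNgt lt_vw.
have sub_w x : e v x -> x != w -> e w x.
  move=> evx neq_xw; have := sub x.
  by rewrite evx neq_xw andbT /= negbK e_sym.
rewrite /deg (cardD1 w) [in X in _ < X](cardD1 v) [in X in _ < X](cardD1 u) !inE.
rewrite evw e_sym evw /= eq_sym neq_vu ewu !add1n ltnS.
rewrite ltnS; apply/subset_leq_card/subsetP => x; rewrite !inE => /andP [neq_xw evx].
rewrite sub_w // andbT; apply/andP; split.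
  by apply: contraNneq nevu => <-.
by apply: contraTneq evx => ->; rewrite e_irr.
Qed.

End Distance.

(** * The distance form of the friendship graph *)

Lemma friendship_sym k : symmetric (friendship k).
Proof.
move=> x y; rewrite /friendship eq_sym; congr (_ && _).
by rewrite orbCA [in X in [|| _, _ | X]]eq_sym.
Qed.

Lemma friendship_irr k : irreflexive (friendship k).
Proof. by move=> x; rewrite /friendship eqxx. Qed.

Definition hub k : 'I_(2 * k + 1) := cast_ord (esym (addn1 (2 * k))) ord0.

Lemma eq_hub k (x : 'I_(2 * k + 1)) : (x == hub k) = (x == 0%N :> nat).
Proof. by []. Qed.

Lemma friendship_hub k : universal (friendship k) (hub k).
Proof. by move=> x; rewrite /friendship /= eq_sym => ->. Qed.

Section FriendshipForms.
Variable k : nat.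
Local Notation V := 'I_(2 * k + 1).
Local Notation D := (distmx (friendship k)).
Implicit Types i j : V.

Lemma friendship_dist i j : D i j =
  (if i == j then 0 else if friendship k i j then 1 else 2)%:R.
Proof.
by rewrite mxE (gdist_universal (@friendship_sym k) (@friendship_irr k) i j (@friendship_hub k)).
Qed.

(** Incidence of the non-hub vertices with the triangles: [2c+1] and [2c+2] lie on triangle [c]. *)
Let blade i (c : 'I_k) : algC := ((i != hub k) && (i.-1./2 == c :> nat))%:R.

Lemma sum_blade i j :
  \sum_c blade i c * blade j c = [&& i != hub k, j != hub k & i.-1./2 == j.-1./2]%:R.
Proof.
have [eq_i|neq_i] := boolP (i == hub k).
  by rewrite big1 // => c _; rewrite /blade eq_i mul0r.
have lt_i : (i.-1./2 < k)%N by have := ltn_ord i; move: neq_i; rewrite eq_hub; lia.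
rewrite (bigD1 (Ordinal lt_i)) //= big1 ?addr0.
  by rewrite /blade neq_i /= eqxx mul1r [X in _ && X]eq_sym.
move=> c neq_c; rewrite /blade; case: (i.-1./2 =P c :> nat) => [eq_ic|]; last by rewrite andbF mul0r.
by case/eqP: neq_c; apply: val_inj.
Qed.

Let B : 'M[algC]_(2 * k + 1, k) := \matrix_(i, c) blade i c.
(** Each column has opposite signs at the two non-hub vertices of its triangle, so the Gram matrix
    has -1 between them, where that of [B] has 1. *)
Let C : 'M[algC]_(2 * k + 1, k) := \matrix_(i, c) ((-1) ^+ i * blade i c).

Lemma BBE i j : (B *m B^t*) i j = [&& i != hub k, j != hub k & i.-1./2 == j.-1./2]%:R.
Proof.
rewrite mxE -sum_blade; apply: eq_bigr => c _.
by rewrite !mxE /blade conjC_nat.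
Qed.

Lemma CCE i j : (C *m C^t*) i j =
  (-1) ^+ (i + j)%N * [&& i != hub k, j != hub k & i.-1./2 == j.-1./2]%:R.
Proof.
rewrite mxE -sum_blade mulr_sumr; apply: eq_bigr => c _.
by rewrite !mxE /blade rmorphM rmorphXn rmorphN1 /= conjC_nat exprD; ring.
Qed.

Lemma friendship_form_ge x : -3 * hform 1%:M x <= hform D x.
Proof.
pose u : 'cV[algC]_(2 * k + 1) := const_mx 1.
pose s : 'cV[algC]_(2 * k + 1) := \col_i (i != hub k)%:R.
pose h : 'cV[algC]_(2 * k + 1) := \col_i (i == hub k)%:R.
(* Between distinct non-hub vertices [u] and [s] give the distance 2, which [C] lowers to 1 inside a
   triangle; [h] and the diagonal of [C] raise every diagonal entry to 3. *)
have eqD : D = u *m u^t* + 2 *: (h *m h^t*) + s *m s^t* + C *m C^t* + (-3) *: 1%:M.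
  apply/matrixP => i j; rewrite friendship_dist; have := CCE i j.
  move: (C *m C^t*) => G GE; rewrite !mxE GE !big_ord1 !mxE rmorph1 !conjC_nat /friendship.
  rewrite !eq_hub; have [<-|neq_ij] := eqVneq i j.
    by rewrite addnn -signr_odd odd_double eqxx; case: eqP => _ /=; ring.
  have {}neq_ij : i != j :> nat by [].
  case: eqP => i0; case: eqP => j0 /=; try ring; first by rewrite i0 j0 in neq_ij.
  case: eqP => [eq_ij|_] /=; last by ring.
  (* The two non-hub vertices of a triangle have opposite parity. *)
  rewrite -signr_odd (_ : odd (i + j)) /=; first by ring.
  by lia.
rewrite eqD !hformD !hformZ lerDr.
by rewrite !addr_ge0 ?mulr_ge0 ?hform_gram_ge0 ?ler0n.
Qed.

(** Only one rank-one term of [D + I/2] is positive, and it vanishes on the hyperplane orthogonal to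
    its vector. *)
Lemma friendship_form_le : exists w : 'cV[algC]_(2 * k + 1),
  forall x, x *m w = 0 -> hform D x <= - 2^-1 * hform 1%:M x.
Proof.
pose w : 'cV[algC]_(2 * k + 1) := \col_i (if i == hub k then 1 else 2).
pose E : 'M[algC]_(2 * k + 1) := \matrix_(i, j) ((i == j) && (i != hub k))%:R.
(* The term in [w] is 1 between the hub and the rest and 2 off the hub; [B] subtracts 1 inside a
   triangle, and [E] corrects the diagonal off the hub. *)
have eqD : D = 2^-1 *: (w *m w^t*) - (B *m B^t* + 2^-1 *: (E *m E^t*)) + (- 2^-1) *: 1%:M.
  apply/matrixP => i j; rewrite friendship_dist.
  have : (E *m E^t*) i j = ((i == j) && (i != hub k))%:R.
    rewrite mxE (bigD1 i) //= big1 ?addr0; last first.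
      by move=> l /negPf neq_l; rewrite !mxE eq_sym neq_l mul0r.
    rewrite !mxE conjC_nat eqxx -natrM mulnb [j == i]eq_sym.
    by case: (eqVneq i j) => [<-|_] /=; rewrite ?andbb ?andbF.
  have := BBE i j.
  move: (B *m B^t*) (E *m E^t*) => G F GE FE.
  rewrite !mxE GE FE !big_ord1 !mxE /friendship !eq_hub.
  have {GE FE} [<-|neq_ij] := eqVneq i j.
    by rewrite eqxx; case: eqP => _ /=; rewrite ?rmorph1 ?conjC_nat; field.
  case: eqP => i0; case: eqP => j0 /=; rewrite ?rmorph1 ?conjC_nat; try by field.
    have {}neq_ij : i != j :> nat by [].
    by rewrite i0 j0 in neq_ij.
  by case: eqP => _ /=; field.
exists w => x xw; rewrite eqD !hformD hformN hformD !hformZ.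
have -> : hform (w *m w^t*) x = 0 by rewrite /hform mulmxA xw !mul0mx mxE.
rewrite mulr0 add0r gerDr oppr_le0.
by rewrite addr_ge0 ?mulr_ge0 ?hform_gram_ge0 ?invr_ge0 ?ler0n.
Qed.
End FriendshipForms.

(** * Excluding paths on four vertices *)

Lemma distmx_normal n (e : rel 'I_n) : symmetric e -> distmx e \is normalmx.
Proof.
move=> e_sym; apply/normalmxP; suff -> : (distmx e)^t* = distmx e by [].
by apply/matrixP => i j; rewrite !mxE conjC_nat gdist_sym.
Qed.

(** The combination with coefficients [c] of the unit vectors at the vertices [f a]. *)
Definition rowat m n (f : 'I_m -> 'I_n) (c : 'rV[algC]_m) : 'rV[algC]_n :=
  c *m rowsub f 1%:M.

Lemma hform_rowat m n (f : 'I_m -> 'I_n) (A : 'M[algC]_n) c :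
  hform A (rowat f c) = \sum_a \sum_b c 0 a * A (f a) (f b) * (c 0 b)^*.
Proof.
have -> : hform A (rowat f c) = (c *m mxsub f f A *m c^t*) 0 0.
  rewrite /hform /rowat trmx_mul map_mxM !mulmxA; congr (_ 0 0); congr (_ *m _).
  rewrite -!mulmxA; congr (_ *m _); apply/matrixP => a b.
  rewrite mulmxA -rowsubE mxE (bigD1 (f b)) //= big1 ?addr0.
    by rewrite !mxE eqxx conjC1 mulr1.
  by move=> j /negPf neq_j; rewrite !mxE eq_sym neq_j conjC0 mulr0.
rewrite mxE exchange_big; apply: eq_bigr => b _ /=; rewrite mxE mulr_suml.
by apply: eq_bigr => a _; rewrite !mxE.
Qed.

Section Path4.
Variables (n : nat) (e : rel 'I_n) (x v w u : 'I_n).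
Hypotheses (e_sym : symmetric e) (e_irr : irreflexive e).
Hypotheses (exv : e x v) (evw : e v w) (ewu : e w u).
Hypotheses (nexw : ~~ e x w) (nevu : ~~ e v u) (neq_xw : x != w) (neq_vu : v != u).
Let f : 'I_4 -> 'I_n := fun i => nth x [:: x; v; w; u] i.
Let row4 (a b c d : algC) : 'rV[algC]_4 := \row_i nth 0 [:: a; b; c; d] i.
Let t : nat := gdist e x u.

Lemma path4_inj : injective f.
Proof.
have neq_edge a b : e a b -> a == b = false.
  by move=> eab; apply: contraTF eab => /eqP ->; rewrite e_irr.
have neq_xu : x == u = false by apply: contraNF nevu => /eqP <-; rewrite e_sym.
have uniq_s : uniq [:: x; v; w; u].
  by rewrite /= !inE (neq_edge x v) // (neq_edge v w) // (neq_edge w u) // neq_xu (negPf neq_xw) (negPf neq_vu).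
move=> i j /eqP; rewrite /f nth_uniq // => /eqP; exact: val_inj.
Qed.

Lemma path4_norm a b c d : hform 1%:M (rowat f (row4 a b c d)) =
  a * a^* + b * b^* + c * c^* + d * d^*.
Proof.
rewrite hform_rowat !big_ord_recl !big_ord0 !mxE !(inj_eq path4_inj) /=.
by ring.
Qed.

(** The non adjacent pairs [x, w] and [v, u] have common neighbours, hence distance 2; only [t]
    stays undetermined. *)
Lemma path4_form a b c d : hform (distmx e) (rowat f (row4 a b c d)) =
   a * b^* + b * a^* + b * c^* + c * b^* + c * d^* + d * c^* +
   2 * (a * c^* + c * a^* + b * d^* + d * b^*) + t%:R * (a * d^* + d * a^*).
Proof.
have dxw : gdist e x w = 2%N.
  by apply/eqP; rewrite eqn_leq (gdist_le2 exv evw) gdist_gt1.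
have dvu : gdist e v u = 2%N.
  by apply/eqP; rewrite eqn_leq (gdist_le2 evw ewu) gdist_gt1.
rewrite hform_rowat !big_ord_recl !big_ord0 !mxE /f /= !gdistxx.
rewrite ![gdist _ v x]gdist_sym // ![gdist _ w _]gdist_sym // ![gdist _ u _]gdist_sym //.
rewrite dxw dvu -/t (gdist_edge e_irr exv) (gdist_edge e_irr evw) (gdist_edge e_irr ewu).
by ring.
Qed.

Lemma path4_not_ge :
  t = 3%N -> ~ (forall y, -3 * hform 1%:M y <= hform (distmx e) y).
Proof.
(* An integer approximation to the eigenvector of the distance matrix of the path on four vertices
   for its least eigenvalue, -2 - sqrt 2 < -3. *)
move=> t3 /(_ (rowat f (row4 2 1 (-1) (-2)))).
rewrite path4_norm path4_form t3 !rmorphN /= !rmorph1 !conjC_nat.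
set l := (X in X <= _); set r := (X in _ <= X).
have -> : l = - 30%:R by rewrite /l; ring.
have -> : r = - 34%:R by rewrite /r; ring.
by rewrite lerN2 ler_nat.
Qed.

(** A plane meets every hyperplane in a nonzero vector, whereas on this plane the form plus half the
    squared norm is positive definite. *)
Lemma path4_not_le : (t <= 2)%N -> ~ (exists z : 'cV[algC]_n,
  forall y, y *m z = 0 -> hform (distmx e) y <= - 2^-1 * hform 1%:M y).
Proof.
move=> le_t2 [z le_z].
pose p := (rowat f (row4 1 1 1 1) *m z) 0 0.
pose q := (rowat f (row4 1 (-2) 2 (-1)) *m z) 0 0.
have [[al be] /= nz0 eq0] : exists2 ab : algC * algC, (ab.1 != 0) || (ab.2 != 0) &
    ab.1 * p + ab.2 * q = 0.
  have [p0|nz_p] := eqVneq p 0.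
    by exists (1, 0); rewrite /= ?oner_eq0 // p0 mulr0 mul0r addr0.
  by exists (- q, p); rewrite /= ?nz_p ?orbT //; ring.
have /le_z : rowat f (row4 (al + be) (al - 2 * be) (al + 2 * be) (al - be)) *m z = 0.
  have -> : row4 (al + be) (al - 2 * be) (al + 2 * be) (al - be) =
      al *: row4 1 1 1 1 + be *: row4 1 (-2) 2 (-1).
    apply/rowP => i; rewrite !mxE.
    by case: i => [[|[|[|[|//]]]] ?] /=; ring.
  rewrite /rowat !mulmxDl -!scalemxAl; apply/matrixP => i j.
  by rewrite !ord1 [RHS]mxE -eq0 /p /q mxE [X in X + _]mxE [X in _ + X]mxE.
rewrite path4_norm path4_form !(rmorphD, rmorphN, rmorphM) /= !conjC1 -subr_ge0.
set r := (X in 0 <= X).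
(* There are no cross terms: reversing the path fixes (1,1,1,1) and negates (1,-2,2,-1). *)
have -> : r = - ((16 + 2 * t)%:R * (al * al^*) + (5 - 2 * t)%:R * (be * be^*)).
  rewrite /r natrB; last by lia.
  by rewrite natrD natrM; field.
rewrite oppr_ge0 => le0.
have t5 : (0 < 5 - 2 * t)%N by lia.
have al_ge0 : 0 <= (16 + 2 * t)%:R * (al * al^*) by rewrite mulr_ge0 ?ler0n ?mul_conjC_ge0.
have be_ge0 : 0 <= (5 - 2 * t)%:R * (be * be^*) by rewrite mulr_ge0 ?ler0n ?mul_conjC_ge0.
move: le0; rewrite le_eqVlt (le_gtF (addr_ge0 al_ge0 be_ge0)) orbF paddr_eq0 //.
rewrite !mulf_eq0 !pnatr_eq0 !conjC_eq0 !orbb addn_eq0 /= eqn0Ngt t5 /=.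
by case/andP=> /eqP al0 /eqP be0; rewrite al0 be0 eqxx in nz0.
Qed.

End Path4.

(** * Degrees, triangles and traces *)

Section Counting.
Variables (n : nat) (e : rel 'I_n).
Hypotheses (e_sym : symmetric e) (e_irr : irreflexive e).

Definition degree i : nat := (\sum_j e i j)%N.
(** Closed walks of length 3: each triangle through [i] counts in both directions, and the sum over
    [i] is the trace of the cubed adjacency matrix. *)
Definition triangles_at i : nat := (\sum_j \sum_k e i j * e j k * e k i)%N.

Section Universal.
Variable v : 'I_n.
Hypothesis v_univ : universal e v.
Local Open Scope nat_scope.

Lemma sum_neq_const c : \sum_(i < n | i != v) c = n.-1 * c.
Proof.
by rewrite sum_nat_const cardC1 card_ord.
Qed.

Lemma degree_universal : degree v = n.-1.
Proof.
rewrite /degree (bigD1 v) //= e_irr -[RHS]muln1 -sum_neq_const.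
by apply: eq_bigr => i neq_i; rewrite v_univ.
Qed.

(** Closed 3-walks at [v] are the ordered adjacent pairs avoiding [v], and each [i != v] has
    [degree i - 1] neighbours other than [v]. *)
Lemma triangles_at_universal : triangles_at v + n.-1 = \sum_(i < n | i != v) degree i.
Proof.
rewrite /triangles_at (bigD1 v) //= big1 => [|k _]; last by rewrite e_irr.
rewrite add0n -[n.-1]muln1 -sum_neq_const -big_split /=.
apply: eq_bigr => j neq_j; rewrite /degree (bigD1 v) //= e_irr muln0 add0n.
rewrite [RHS](bigD1 v) //= [e j v]e_sym v_univ // addnC; congr (_ + _).
by apply: eq_bigr => k neq_k; rewrite [e k v]e_sym v_univ // muln1 mul1n.
Qed.

(** A closed 3-walk at [i] is an ordered pair of distinct neighbours of [i]. *)
Lemma triangles_at_le i : triangles_at i + degree i <= degree i ^ 2.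
Proof.
rewrite -mulnn /triangles_at /degree big_distrl /= -big_split /=.
apply: leq_sum => j _; rewrite big_distrr /=.
rewrite (bigD1 j) //= [leqRHS](bigD1 j) //= e_irr muln0 mul0n add0n mulnb andbb addnC.
rewrite leq_add2l; apply: leq_sum => k _; rewrite [e k i]e_sym.
by case: (e i j); case: (e j k); case: (e i k).
Qed.

(** Every neighbour of [i] other than [v] forms a triangle with [i] and [v], counted in both
    directions. *)
Lemma triangles_at_ge i : i != v -> 2 * degree i <= triangles_at i + 2.
Proof.
move=> neq_i; rewrite mul2n -addnn /triangles_at.
have e_vi : e v i by rewrite v_univ.
have deg_i : degree i = 1 + \sum_(j < n | j != v) e i j.
  by rewrite /degree (bigD1 v) //= e_sym e_vi.
rewrite (bigD1 v) //= deg_i [e i v]e_sym e_vi.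
have -> : \sum_k true * e v k * e k i = \sum_(j < n | j != v) e i j.
  rewrite (bigD1 v) //= e_irr; apply: eq_bigr => k neq_k.
  by rewrite v_univ // e_sym !mul1n.
suff : \sum_(j < n | j != v) e i j <= \sum_(j < n | j != v) \sum_k e i j * e j k * e k i.
  move: (\sum_(j < n | j != v) e i j) (\sum_(j < n | j != v) \sum_k _) => s t.
  by lia.
apply: leq_sum => j neq_j; rewrite (bigD1 v) //= [e j v]e_sym v_univ // e_vi.
by rewrite !muln1 leq_addr.
Qed.

Lemma sum_triangles_le :
  \sum_i triangles_at i + n.-1 <= \sum_(i < n | i != v) degree i ^ 2.
Proof.
rewrite (bigD1 v) //= addnAC triangles_at_universal -big_split /=.
by apply: leq_sum => i _; rewrite addnC triangles_at_le.
Qed.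

(** For the friendship graph, whose degrees off the hub are 2, this yields at least [3 * n.-1]
    closed 3-walks. *)
Lemma sum_triangles_ge :
  3 * \sum_(i < n | i != v) degree i <= \sum_i triangles_at i + 3 * n.-1.
Proof.
rewrite [\sum_i triangles_at i](bigD1 v) //=; have := triangles_at_universal.
have : 2 * \sum_(i < n | i != v) degree i <=
    \sum_(i < n | i != v) triangles_at i + n.-1 * 2.
  by rewrite -sum_neq_const -big_split big_distrr; apply: leq_sum => i /triangles_at_ge.
move: (\sum_(i < n | i != v) triangles_at i) (\sum_(i < n | i != v) degree i) => s t.
by lia.
Qed.
End Universal.

Let A : 'M[algC]_n := \matrix_(i, j) (e i j)%:R.
Let J : 'M[algC]_n := const_mx 1.

Lemma trJ (M : 'M[algC]_n) : \tr (J *m M) = \sum_i \sum_j M i j.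
Proof.
rewrite exchange_big; apply: eq_bigr => i _; rewrite mxE.
by apply: eq_bigr => j _; rewrite mxE mul1r.
Qed.

Lemma trJA : \tr (J *m A) = (\sum_i degree i)%:R.
Proof.
rewrite trJ natr_sum; apply: eq_bigr => i _; rewrite natr_sum.
by apply: eq_bigr => j _; rewrite mxE.
Qed.

Lemma trAA : \tr (A *m A) = (\sum_i degree i)%:R.
Proof.
rewrite natr_sum; apply: eq_bigr => i _; rewrite natr_sum mxE.
by apply: eq_bigr => j _; rewrite !mxE [e j i]e_sym -natrM mulnb andbb.
Qed.

Lemma trJAA : \tr (J *m (A *m A)) = (\sum_i degree i ^ 2)%:R.
Proof.
rewrite trJ natr_sum.
(* Walks of length 2 are regrouped by their middle vertex. *)
have -> : \sum_i \sum_j (A *m A) i j = \sum_i \sum_k \sum_j A i k * A k j.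
  apply: eq_bigr => i _; rewrite exchange_big.
  by apply: eq_bigr => j _; rewrite mxE.
rewrite exchange_big /=; apply: eq_bigr => k _.
rewrite natrX expr2 /degree !natr_sum mulr_suml; apply: eq_bigr => i _.
by rewrite mulr_sumr; apply: eq_bigr => j _; rewrite !mxE e_sym.
Qed.

Lemma trAAA : \tr (A *m A *m A) = (\sum_i triangles_at i)%:R.
Proof.
rewrite -mulmxA natr_sum; apply: eq_bigr => i _; rewrite natr_sum mxE.
apply: eq_bigr => j _; rewrite natr_sum [(A *m A) j i]mxE mulr_sumr.
by apply: eq_bigr => k _; rewrite !mxE -!natrM mulnA.
Qed.

Lemma JJ : J *m J = n%:R *: J.
Proof.
apply/matrixP => i j; rewrite !mxE mulr1.
under eq_bigr do rewrite !mxE mulr1.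
by rewrite sumr_const card_ord.
Qed.

Section Traces.
Variable v : 'I_n.
Hypothesis v_univ : universal e v.

Lemma distmx_universal : distmx e = 2 *: J - (2%:M + A).
Proof.
apply/matrixP => i j; rewrite !mxE (gdist_universal e_sym e_irr i j v_univ).
by case: eqVneq => [->|_]; rewrite ?e_irr //=; case: (e i j) => /=; ring.
Qed.

Let tr1 : \tr (1%:M : 'M[algC]_n) = n%:R.
Proof. exact: mxtrace1. Qed.

Let trA : \tr A = 0.
Proof. by rewrite /mxtrace big1 // => i _; rewrite mxE e_irr. Qed.

Let tJ : \tr J = n%:R.
Proof.
by rewrite /mxtrace (eq_bigr (fun=> 1)) ?sumr_const ?card_ord // => i _; rewrite mxE.
Qed.

Let trN (M : 'M[algC]_n) : \tr (- M) = - \tr M.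
Proof. by rewrite raddfN. Qed.

Let mulmx_expand :=
  (mulmxBl, mulmxBr, mulmxDl, mulmxDr, mulmxN, mulNmx, mulmx1, mul1mx).
Let mxtrace_expand := (mxtraceD, mxtraceZ, trN).

Lemma trace_dist2 : \tr (distmx e *m distmx e) =
  4 * n%:R ^+ 2 - 4 * n%:R - 3 * (\sum_i degree i)%:R.
Proof.
rewrite distmx_universal -[2%:M]scalemx1.
rewrite !mulmx_expand -!(scalemxAl, scalemxAr) !mulmx_expand JJ !mxtrace_expand.
rewrite [\tr (A *m J)]mxtrace_mulC trJA trAA tr1 trA tJ.
by ring.
Qed.

Lemma trace_dist3 : \tr (distmx e *m distmx e *m distmx e) =
  8 * n%:R ^+ 3 - 12 * n%:R * (2 * n%:R + (\sum_i degree i)%:R) + 16 * n%:R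
  + 18 * (\sum_i degree i)%:R + 6 * (\sum_i degree i ^ 2)%:R
  - (\sum_i triangles_at i)%:R.
Proof.
rewrite distmx_universal -[2%:M]scalemx1.
do 3!rewrite ?mulmx_expand -?(scalemxAl, scalemxAr) ?JJ.
(* Cyclicity of the trace and [JJ] reduce the mixed words in [J] and [A] to [trJA] and [trJAA]. *)
have trAJJ : \tr (A *m J *m J) = n%:R * (\sum_i degree i)%:R.
  by rewrite -mulmxA JJ -scalemxAr mxtraceZ mxtrace_mulC trJA.
have trJAJ : \tr (J *m A *m J) = n%:R * (\sum_i degree i)%:R.
  by rewrite mxtrace_mulC mulmxA JJ -scalemxAl mxtraceZ trJA.
have trAAJ : \tr (A *m A *m J) = (\sum_i degree i ^ 2)%:R.
  by rewrite mxtrace_mulC trJAA.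
have trAJA : \tr (A *m J *m A) = (\sum_i degree i ^ 2)%:R.
  by rewrite -mulmxA mxtrace_mulC -mulmxA trJAA.
have trJAA' : \tr (J *m A *m A) = (\sum_i degree i ^ 2)%:R.
  by rewrite -mulmxA trJAA.
rewrite !mxtrace_expand trAJJ trJAJ trAAJ trAJA trJAA' trAAA.
rewrite [\tr (A *m J)]mxtrace_mulC trJA trAA tr1 trA tJ.
by ring.
Qed.
End Traces.
End Counting.

Lemma friendship_degree k i : i != hub k -> degree (friendship k) i = 2%N.
Proof.
rewrite eq_hub => neq_i.
(* The neighbour of [i] other than the hub: the successor of an odd vertex, the predecessor of an
   even one. *)
have lt_m : ((if odd i then i.+1 else i.-1) < 2 * k + 1)%N.
  by have := ltn_ord i; case: ifP; lia.
rewrite /degree (bigD1 (hub k)) //= (bigD1 (Ordinal lt_m)) /=; last first.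
  by rewrite eq_hub /=; case: ifP; lia.
rewrite big1 ?addn0; last first.
  move=> j /andP []; rewrite eq_hub => neq_j neq_jm.
  have {neq_jm} : (j : nat) != (if odd i then i.+1 else i.-1) by [].
  rewrite /friendship (negPf neq_i) (negPf neq_j) /=.
  have -> : (i != j) = (i != j :> nat) by [].
  by case: (i.-1./2 =P j.-1./2); rewrite ?andbF //; case: ifP; lia.
rewrite {1}/friendship eq_hub neq_i /= /friendship /= (negPf neq_i).
have -> : (i != Ordinal lt_m) = (i != (if odd i then i.+1 else i.-1) :> nat) by [].
case: ifP => odd_i.
  have -> : i.-1./2 == i.+1.-1./2 by lia.
  by have -> : (i : nat) != i.+1 by lia.
have -> : i.-1./2 == i.-1.-1./2 by lia.
have -> : (i : nat) != i.-1 by lia. by case: (_ == _).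
Qed.

(** Write N for [n.-1], q for the sum of squared degrees of [e] off [v], and T for the sums of
    [triangles_at]. The traces give degree sum 2N off [v] and 6q + T(f) = 24N + T(e). With T(e) + N
    <= q and T(f) >= 3N this forces q <= 4N. *)
Lemma degrees_two n (e f : rel 'I_n) v w :
  symmetric e -> irreflexive e -> universal e v ->
  symmetric f -> irreflexive f -> universal f w ->
  \tr (distmx e *m distmx e) = \tr (distmx f *m distmx f) ->
  \tr (distmx e *m distmx e *m distmx e) = \tr (distmx f *m distmx f *m distmx f) ->
  (forall i, i != w -> degree f i = 2%N) -> forall i, i != v -> degree e i = 2%N.
Proof.
move=> e_sym e_irr ev f_sym f_irr fw.
rewrite (trace_dist2 e_sym e_irr ev) (trace_dist2 f_sym f_irr fw).
rewrite (trace_dist3 e_sym e_irr ev) (trace_dist3 f_sym f_irr fw).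
move=> eq2 eq3 deg_f.
have eq_deg : (\sum_i degree e i = \sum_i degree f i)%N.
  apply/eqP; rewrite -(eqr_nat algC); apply/eqP.
  move: eq2 => /addrI/oppr_inj/mulfI; apply; first by rewrite pnatr_eq0.
rewrite eq_deg in eq3.
have {}eq3 : (6 * \sum_i degree e i ^ 2 + \sum_i triangles_at f i =
              6 * \sum_i degree f i ^ 2 + \sum_i triangles_at e i)%N.
  apply/eqP; rewrite -(eqr_nat algC) natrD [X in _ == X]natrD !(natrM _ 6); apply/eqP.
  move/eqP: eq3; rewrite -subr_eq0 => /eqP eq3; apply/eqP; rewrite -subr_eq0 -eq3.
  by apply/eqP; ring.
have := sum_triangles_le e_sym e_irr ev; have := sum_triangles_ge f_sym f_irr fw.
move: eq_deg eq3.
rewrite (bigD1 v) //= (degree_universal e_irr ev).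
rewrite [(\sum_i degree f i)%N](bigD1 w) //= (degree_universal f_irr fw).
rewrite [(\sum_i degree e i ^ 2)%N](bigD1 v) //= (degree_universal e_irr ev).
rewrite [(\sum_i degree f i ^ 2)%N](bigD1 w) //= (degree_universal f_irr fw).
rewrite [(\sum_(i < n | i != w) degree f i)%N](eq_bigr (fun=> 2%N)) //.
rewrite [(\sum_(i < n | i != w) degree f i ^ 2)%N](eq_bigr (fun=> 4%N)); last first.
  by move=> i /deg_f ->.
rewrite !sum_neq_const.
(* This is (d - 2)^2 >= 0 written without subtraction; equality of the sums forces every d to be
   2. *)
have le4 : (\sum_(i < n | i != v) 4 * degree e i <=
    \sum_(i < n | i != v) (degree e i ^ 2 + 4) ?= iff
    [forall (i | i != v), degree e i == 2%N])%N.
  apply: leqif_sum => i _; apply/leqifP.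
  by case: eqVneq => [-> //|neq2]; rewrite -mulnn; nia.
move=> eq_deg eq3 leT geT i neq_i.
suff : [forall (i | i != v), degree e i == 2%N].
  by move=> /forallP /(_ i) /implyP /(_ neq_i) /eqP.
rewrite -le4.2 eqn_leq le4.1 /= big_split /= sum_neq_const -big_distrr /=.
move: eq_deg eq3 leT geT.
move: (\sum_(i < n | i != v) degree e i)%N (\sum_(i < n | i != v) degree e i ^ 2)%N.
move: (\sum_i triangles_at e i)%N (\sum_i triangles_at f i)%N n.-1 => T1 T2 N s q.
by lia.
Qed.

(** * Reconstruction of the friendship graph *)

Section Windmill.
Variables (k : nat) (e : rel 'I_(2 * k + 1)) (v : 'I_(2 * k + 1)).
Hypotheses (e_sym : symmetric e) (e_irr : irreflexive e) (v_univ : universal e v).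
Hypothesis deg2 : forall i, i != v -> degree e i = 2%N.
Local Open Scope nat_scope.
Implicit Types i j : 'I_(2 * k + 1).

Let mate i := odflt i [pick j | (j != v) && e i j].

(** One of the two neighbours of [i] is [v], so exactly one other remains and [pick] finds it. *)
Lemma mateP i j : i != v -> j != v -> e i j = (j == mate i).
Proof.
move=> neq_i neq_j.
have /mem_card1 [m mP] : #|[pred j | (j != v) && e i j]| = 1.
  have := deg2 neq_i; rewrite /degree (bigD1 v) //= e_sym v_univ // => -[].
  by rewrite -sum1_card /= big_mkcondr.
have mate_m : mate i = m.
  rewrite /mate; case: pickP => [j' /= Pj'|/(_ m)/=].
    by have := mP j'; rewrite !inE Pj' => /esym/eqP.
  by have := mP m; rewrite !inE eqxx => ->.
by have := mP j; rewrite !inE neq_j mate_m.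
Qed.

Lemma mate_neq i : i != v -> mate i != v.
Proof.
move=> neq_i; rewrite /mate; case: pickP => //= j /andP [] //.
Qed.

Lemma mateK i : i != v -> mate (mate i) = i.
Proof.
move=> neq_i; apply/esym/eqP; rewrite -mateP ?mate_neq // e_sym.
by rewrite mateP ?mate_neq.
Qed.

Lemma mate_neq_id i : i != v -> mate i != i.
Proof.
by move=> neq_i; rewrite eq_sym -mateP // e_irr.
Qed.

(** The smaller end of each edge avoiding [v]; these representatives number the triangles. *)
Let lows := [set i | (i != v) && (i < mate i)].
Let low i := if i < mate i then i else mate i.

Lemma low_lows i : i != v -> low i \in lows.
Proof.
move=> neq_i; rewrite /low inE; case: ltnP => [-> //|le_mi]; first by rewrite neq_i.
rewrite mate_neq // mateK // ltn_neqAle le_mi andbT.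
exact: mate_neq_id.
Qed.

(** [lows] and its image under [mate] are disjoint, equally large, and lie among the [2 * k]
    vertices other than [v]. *)
Lemma card_lows : #|lows| <= k.
Proof.
have inj : {in lows &, injective mate}.
  move=> i j; rewrite !inE => /andP [neq_i _] /andP [neq_j _] eq_m.
  by rewrite -(mateK neq_i) eq_m mateK.
have dis : [disjoint lows & mate @: lows].
  rewrite disjoint_subset; apply/subsetP => i; rewrite !inE => /andP [neq_i lt_i].
  apply/imsetP => -[j]; rewrite inE => /andP [neq_j lt_j] eq_i.
  by move: lt_i lt_j; rewrite eq_i mateK //; lia.
have : #|lows :|: mate @: lows| <= #|[set~ v]|.
  apply/subset_leq_card/subsetP => i; rewrite !inE => /orP [/andP []//|].
  by case/imsetP => j; rewrite inE => /andP [neq_j _] ->; rewrite mate_neq.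
rewrite cardsC1 card_ord cardsU (disjoint_setI0 dis) cards0 subn0 (card_in_imset inj).
by lia.
Qed.

Lemma eq_low i j : i != v -> j != v -> (low i == low j) = (i == j) || (j == mate i).
Proof.
move=> neq_i neq_j; rewrite /low.
have eq_mate : (mate i == j) = (j == mate i) by rewrite eq_sym.
have eq_mate' : (i == mate j) = (j == mate i).
  by rewrite -!mateP // e_sym.
have eq_mates : (mate i == mate j) = (i == j).
  by apply/eqP/eqP => [eq_m|-> //]; rewrite -(mateK neq_i) eq_m mateK.
case: (ltnP i (mate i)) => lt_i; case: (ltnP j (mate j)) => lt_j;
  rewrite ?eq_mate' ?eq_mates ?eq_mate.
- case: (eqVneq j (mate i)) => [eq_j|_]; last by rewrite orbF.
  by move: lt_i lt_j; rewrite eq_j mateK //; lia.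
- by case: (eqVneq i j) => // eq_ij; move: lt_i lt_j; rewrite eq_ij; lia.
- by case: (eqVneq i j) => // eq_ij; move: lt_i lt_j; rewrite eq_ij; lia.
- case: (eqVneq j (mate i)) => [eq_j|_]; last by rewrite orbF.
  move: lt_i lt_j (mate_neq_id neq_i); rewrite eq_j mateK // -val_eqE /=.
  by lia.
Qed.

(** The pair at index c of [lows] gets the labels 2c+1 (smaller end) and 2c+2, those of triangle c
    in [friendship]; [v] gets the hub's label. *)
Let label i := if i == v then 0 else (index (low i) (enum lows)).*2 + (mate i < i) + 1.

Lemma label_lt i : label i < 2 * k + 1.
Proof.
rewrite /label; case: eqVneq => [_|neq_i]; first by rewrite addn1.
have : index (low i) (enum lows) < k.
  by apply: leq_trans card_lows; rewrite cardE index_mem mem_enum low_lows.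
by case: (mate i < i); lia.
Qed.

Lemma label_eq0 i : (label i == 0) = (i == v).
Proof. by rewrite /label; case: (i == v) => //; rewrite addn1. Qed.

Lemma label_half i : i != v -> (label i).-1./2 = index (low i) (enum lows).
Proof.
move=> neq_i; rewrite /label (negPf neq_i).
by case: (mate i < i); lia.
Qed.

Lemma eq_index_low i j : i != v -> j != v ->
  (index (low i) (enum lows) == index (low j) (enum lows)) = (i == j) || (j == mate i).
Proof.
move=> neq_i neq_j; rewrite -eq_low //; apply/eqP/eqP => [|-> //].
by apply: (index_inj v); rewrite mem_enum low_lows.
Qed.

Lemma label_inj : injective label.
Proof.
move=> i j eq_l; have := label_eq0 i; rewrite eq_l label_eq0.
have [-> /esym/eqP //|neq_j /esym/negbT neq_i] := eqVneq j v.
have : (label i).-1./2 == (label j).-1./2 by rewrite eq_l.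
rewrite !label_half // eq_index_low // => /orP [/eqP //|/eqP eq_j].
(* For [j = mate i] the indices agree, but the comparison bits are opposite. *)
move: eq_l; rewrite /label (negPf neq_i) (negPf neq_j).
have /eqP -> : index (low i) (enum lows) == index (low j) (enum lows).
  by rewrite eq_index_low // eq_j eqxx orbT.
have := mate_neq_id neq_i; rewrite eq_j mateK // -val_eqE /=.
by case: ltngtP => //=; lia.
Qed.

Lemma windmill_friendship : isomorphic e (friendship k).
Proof.
pose g i : 'I_(2 * k + 1) := Ordinal (label_lt i).
have g_inj : injective g by move=> i j [] /label_inj.
exists g; split; first exact: injF_bij.
move=> i j; rewrite /friendship (inj_eq g_inj) /= !label_eq0.
have [<-|neq_ij] := eqVneq i j; first by rewrite e_irr.
have [eq_i|neq_i] := eqVneq i v; first by rewrite eq_i v_univ // -eq_i eq_sym.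
have [eq_j|neq_j] := eqVneq j v; first by rewrite eq_j e_sym v_univ // -eq_j.
by rewrite !label_half // eq_index_low // (negPf neq_ij) mateP.
Qed.
End Windmill.

(* Transfer of the forms and traces to a cospectral graph *)
Local Close Scope ring_scope.

Theorem theorem3p6 (k : nat) (hk : 2 <= k) (m : nat) (e : rel 'I_m)
  (hG : simple_graph e) (hconn : connected_graph e)
  (hcosp : D_cospectral e (friendship k)) :
  isomorphic e (friendship k).
Proof.
(* The degree of the characteristic polynomial is the number of vertices. *)
have eq_m : m = 2 * k + 1.
  by have := congr1 (fun p : {poly algC} => size p) hcosp; rewrite !size_char_poly => -[].
subst m; have [e_sym e_irr] := hG.
have f_sym := @friendship_sym k; have f_irr := @friendship_irr k.
have [U uU eqD] : exists2 U : 'M[algC]_(2 * k + 1), U \is unitarymx &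
    (distmx e = U *m distmx (friendship k) *m U^t*)%R.
  by apply: cospectral_unitarily_similar; rewrite ?distmx_normal.
have UtU : (U^t* *m U = 1%:M)%R by apply: mulmx1C; apply/unitarymxP.
have card_gt0 : 0 < #|'I_(2 * k + 1)| by rewrite card_ord addn1.
have [[v v_univ]|] := universal_or_path4 e_sym e_irr hconn card_gt0.
- apply: (windmill_friendship e_sym e_irr v_univ).
  apply: (degrees_two e_sym e_irr v_univ f_sym f_irr (@friendship_hub k)) => //.
  + by rewrite eqD !mulmxA mulmxKtV // mxtrace_mulC !mulmxA UtU mul1mx.
  + by rewrite eqD !mulmxA !mulmxKtV // mxtrace_mulC !mulmxA UtU mul1mx.
  + exact: friendship_degree.
case=> [x [v [w [u [[exv evw ewu] [nexw nevu neq_xw neq_vu]]]]]].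
have := gdist_le3 exv evw ewu; rewrite leq_eqVlt => /orP [/eqP t3|le_t2].
  case: (path4_not_ge e_sym e_irr exv evw ewu nexw nevu neq_xw neq_vu t3) => y.
  by rewrite eqD hform_conj -(hform1_unitary y uU) friendship_form_ge.
have [z le_z] := friendship_form_le k.
case: (path4_not_le e_sym e_irr exv evw ewu nexw nevu neq_xw neq_vu le_t2).
(* The hyperplane is pulled back along [y *m U]. *)
exists (U *m z)%R => y; rewrite mulmxA => yz.
by rewrite eqD hform_conj -(hform1_unitary y uU) le_z.
Qed.
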